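(* Let $G$ be a finite connected loopless undirected multigraph and let $\mathcal{O}$ and $\mathcal{O}'$ be partial orientations of $G$. Then $\mathcal{O}$ and $\mathcal{O}'$ are equivalent in the generalized cycle--cocycle reversal system if and only if their associated divisors $D_{\mathcal{O}}$ and $D_{\mathcal{O}'}$ are linearly equivalent.
   Context: A divisor on $G$ is a function $D:V(G)\to\mathbb{Z}$. Firing a vertex $v$ lowers $D(v)$ by $\deg(v)$ and raises $D(w)$, for each $w\ne v$, by the number of edges between $v$ and $w$. Two divisors are linearly equivalent, $D\sim D'$, if one is obtained from the other by a sequence of firings and inverse firings, i.e. $D-D'$ lies in the $\mathbb{Z}$-span of the columns of the Laplacian matrix $\Delta$ of $G$. A partial orientation $\mathcal{O}$ of $G$ is a choice of direction for each edge in some subset of $E(G)$; the remaining edges are unoriented. Its associated divisor is $D_{\mathcal{O}}(v)=\mathrm{indeg}_{\mathcal{O}}(v)-1$, where $\mathrm{indeg}_{\mathcal{O}}(v)$ is the number of edges oriented towards $v$. Moves on partial orientations: - Edge pivot at $v$: an edge oriented towards $v$ becomes unoriented and an unoriented edge incident to $v$ becomes oriented towards $v$. - Cocycle (cut) reversal: if for some nonempty proper $X\subset V(G)$ every edge of the cut $(X,X^c)$ is oriented and all are oriented in the same direction across the cut, reverse all edges of the cut. - Cycle reversal: reverse all edges of a consistently oriented (directed) cycle. Two partial orientations are equivalent in the generalized cycle--cocycle reversal system if they are related by a finite sequence of edge pivots, cocycle reversals and cycle reversals. *)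

(* Defs.v *)
From Stdlib Require Import Relation_Operators.
From mathcomp Require Import all_boot all_order all_algebra.

Set Implicit Arguments.
Unset Strict Implicit.
Unset Printing Implicit Defensive.

Import GRing.Theory.
Local Open Scope ring_scope.

(* The two endpoints of an edge are indexed by bool. The indexing is only a
   device for naming the ends; parallel edges are allowed, loops are not. *)
Record multigraph := Multigraph {
  vertex : finType;
  edge : finType;
  endpt : edge -> bool -> vertex;
  endpt_neq : forall e, endpt e false != endpt e true
}.

Section Graph.
Variable G : multigraph.
Local Notation V := (vertex G).
Local Notation E := (edge G).
Implicit Types (e f : E) (u v w : V) (X : {set V}).

Definition incident e v : bool := [exists b, endpt e b == v].

Definition joins e v w : bool :=
  [exists b, (endpt e b == v) && (endpt e (~~ b) == w)].

Definition adjacent : rel V := fun v w => [exists e, joins e v w].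

Definition connected : Prop :=
  (0 < #|V|)%N /\ forall v w, connect adjacent v w.

Definition deg v : nat := #|[set e | incident e v]|.

Definition mult v w : nat := #|[set e | joins e v w]|.

Definition divisor := {ffun V -> int}.
Implicit Types D : divisor.

Definition fire v D : divisor :=
  [ffun w => if w == v then D w - (deg v)%:Z else D w + (mult v w)%:Z].

Definition firing_step D D' : Prop :=
  exists v, D' = fire v D \/ D = fire v D'.

Definition lin_equiv : divisor -> divisor -> Prop :=
  clos_refl_trans divisor firing_step.

Definition laplacian w v : int :=
  if w == v then (deg v)%:Z else - (mult v w)%:Z.

Lemma fireE v D w : fire v D w = D w - laplacian w v.
Proof. by rewrite ffunE /laplacian; case: eqP; rewrite ?opprK. Qed.

Lemma lin_equivP D D' :
  lin_equiv D D' <->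
  exists c : V -> int, forall w, D w - D' w = \sum_v laplacian w v * c v.
Proof.
have one w v (a : int) :
    \sum_u laplacian w u * (if u == v then a else 0) = laplacian w v * a.
  rewrite (bigD1 v) //= eqxx big1 ?addr0 // => u /negbTE ->.
  by rewrite mulr0.
split.
- elim=> [{}D {}D' [v []->]|{}D|D1 D2 D3 _ [c Hc] _ [d Hd]].
  + by exists (fun u => if u == v then 1 else 0) => w;
      rewrite one fireE mulr1 subKr.
  + exists (fun u => if u == v then -1 else 0) => w.
    by rewrite one fireE mulrN1 addrAC subrr add0r.
  + by exists (fun=> 0) => w; rewrite subrr big1 // => u _; rewrite mulr0.
  + exists (fun u => c u + d u) => w.
    rewrite -(subrKA (D2 w)) Hc Hd -big_split.
    by apply: eq_bigr => u _; rewrite mulrDr.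
- case=> c Hc.
  have many v (n : nat) D1 D2 :
      (forall w, D1 w - D2 w = laplacian w v * n%:Z) ->
      lin_equiv D1 D2 /\ lin_equiv D2 D1.
    elim: n D1 D2 => [|n IHn] D1 D2 H.
      suff -> : D1 = D2 by split; apply: rt_refl.
      by apply/ffunP => w; apply/eqP; rewrite -subr_eq0 H mulr0.
    have /IHn[H1 H2] w : fire v D1 w - D2 w = laplacian w v * n%:Z.
      by rewrite fireE addrAC H -addn1 PoszD mulrDr mulr1 addrK.
    split; [apply: (rt_trans _ _ _ _ _ _ H1) | apply: (rt_trans _ _ _ _ _ H2)].
      by apply: rt_step; exists v; left.
    by apply: rt_step; exists v; right.
  have : forall (s : seq V) D1,
      (forall w, D1 w - D' w = \sum_(v <- s) laplacian w v * c v) ->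
      lin_equiv D1 D'.
    elim=> [|v s IHs] D1 H.
      suff -> : D1 = D' by apply: rt_refl.
      by apply/ffunP => w; apply/eqP; rewrite -subr_eq0 H big_nil.
    pose D2 : divisor := [ffun w => D1 w - laplacian w v * c v].
    apply: (rt_trans _ _ _ D2); last first.
      by apply: IHs => w; rewrite ffunE addrAC H big_cons addrAC subrr add0r.
    case cE: (c v) => [n|n].
      by apply: (proj1 (many v n D1 D2 _)) => w; rewrite ffunE subKr cE.
    apply: (proj2 (many v n.+1 D2 D1 _)) => w.
    by rewrite ffunE addrAC subrr add0r cE NegzE mulrN opprK.
  by move/(_ (index_enum _) D); apply.
Qed.

(* [O e = Some b]: e is oriented towards [endpt e b], hence away from
   [endpt e (~~ b)]; [O e = None]: e is unoriented. *)
Definition porient := {ffun E -> option bool}.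
Implicit Types O : porient.

Definition towards O e v : bool :=
  [exists b, (O e == Some b) && (endpt e b == v)].

Definition indeg O v : nat := #|[set e | towards O e v]|.

Definition orient_div O : divisor := [ffun v => (indeg O v)%:Z - 1].

Definition reverse (A : {set E}) O : porient :=
  [ffun e => if e \in A then omap negb (O e) else O e].

Definition edge_pivot O O' : Prop :=
  exists v e f b,
    [/\ towards O e v, O f = None, endpt f b = v &
        O' = [ffun g => if g == e then None
                        else if g == f then Some b else O g]].

Definition cut X : {set E} :=
  [set e | (endpt e false \in X) != (endpt e true \in X)].

Definition directed_cut O X : Prop :=
  exists inward : bool, forall e, e \in cut X ->
    exists2 b, O e = Some b & (endpt e b \in X) = inward.

Definition cocycle_reversal O O' : Prop :=
  exists X, [/\ X != set0, X != [set: V], directed_cut O X &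
                O' = reverse (cut X) O].

(* A directed cycle is given by its successive darts (e, b), each traversing e
   towards [endpt e b]; vertices are not repeated. *)
Definition directed_cycle O (s : seq (E * bool)) : bool :=
  [&& s != [::],
      all (fun d => O d.1 == Some d.2) s,
      cycle (fun d d' => endpt d.1 d.2 == endpt d'.1 (~~ d'.2)) s &
      uniq [seq endpt d.1 d.2 | d <- s]].

Definition cycle_reversal O O' : Prop :=
  exists2 s, directed_cycle O s & O' = reverse [set e in map fst s] O.

Definition gccr_move O O' : Prop :=
  [\/ edge_pivot O O', cocycle_reversal O O' | cycle_reversal O O'].

Definition gccr_equiv : porient -> porient -> Prop :=
  clos_refl_trans porient gccr_move.

End Graph.

(* Main.v *)
(* Write [D_O - D_O'] as the Laplacian of [- a] with [a >= 0] vanishing somewhere,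
   and induct on the sum of [a]. If [a = 0], the indegrees agree: where [O] and [O']
   disagree, either a pivot of [O] removes a disagreement, or the disagreeing edges
   are oppositely oriented and contain a directed cycle of [O], which is reversed.
   Otherwise let [X] be the proper subset where [a = 0]. Among the orientations with
   the indegrees of [O], pick one with the most edges of the cut of [X] directed into
   [X]. Then the set [X1] of vertices reachable from [X] by directed paths leaving [X]
   at once has its whole cut directed inwards; counting indegrees outside [X] shows
   that [X1] is proper. Reversing this cut lowers [a] by one off [X1]. *)
Require Import Defs.
From Stdlib Require Import Relation_Operators.
From mathcomp Require Import all_boot all_order all_algebra.
From mathcomp Require Import zify.

Set Implicit Arguments.
Unset Strict Implicit.
Unset Printing Implicit Defensive.

Import GRing.Theory Num.Theory.

Section Graph.
Variable G : multigraph.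
Local Notation V := (vertex G).
Local Notation E := (edge G).
Implicit Types (e f g h : E) (u v w : V) (X : {set V}) (O : porient G).

(** * Indegrees under pivots and cycle reversals *)

Lemma endpt_inj e : injective (endpt e).
Proof.
move=> [] [] //= eq_e; have := endpt_neq e; by rewrite eq_e eqxx.
Qed.

Lemma endpt_eqN e b : (endpt e b == endpt e (~~ b)) = false.
Proof. by rewrite (inj_eq (@endpt_inj e)); case: b. Qed.

Lemma towardsE O e v :
  towards O e v = (if O e is Some b then endpt e b == v else false).
Proof.
apply/existsP/idP => [[b /andP[/eqP-> //]]|].
by case: (O e) => // b eq_v; exists b; rewrite eqxx.
Qed.

Lemma incidentP e v : reflect (exists b, endpt e b = v) (incident e v).
Proof.
by apply: (iffP existsP) => -[b bP]; exists b; apply/eqP; rewrite bP.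
Qed.

Lemma indegE O v : indeg O v = \sum_e towards O e v.
Proof. by rewrite /indeg cardsE -sum1_card big_mkcond. Qed.

Definition pivot O e f b : porient G :=
  [ffun g => if g == e then None else if g == f then Some b else O g].

Lemma pivot_move O e f b :
  towards O e (endpt f b) -> O f = None -> gccr_move O (pivot O e f b).
Proof. by move=> Oe Of; apply: Or31; exists (endpt f b), e, f, b. Qed.

Lemma towards_neq O e f v : towards O e v -> O f = None -> f != e.
Proof. by move=> + Of; apply: contraTneq => <-; rewrite towardsE Of. Qed.

Lemma indeg_pivot O e f b v :
  towards O e (endpt f b) -> O f = None -> indeg (pivot O e f b) v = indeg O v.
Proof.
move=> Oe Of; have nef := towards_neq Oe Of.
rewrite !indegE (bigD1 e) // (bigD1 f) // [RHS](bigD1 e) //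
  [X in _ = _ + X](bigD1 f) //=.
rewrite !addnA; congr (_ + _); last first.
  apply: eq_bigr => g /andP[/negbTE ge /negbTE gf].
  by rewrite !towardsE ffunE ge gf.
rewrite !towardsE !ffunE !eqxx (negbTE nef) Of addn0 add0n.
by move: Oe; rewrite towardsE; case: (O e) => // c /eqP->.
Qed.

(** The heads of the reversed darts are the old tails, and around a cycle the list of tails is a
    rotation of the list of heads. So each vertex is counted equally often. *)
Lemma indeg_cycle_reversal O O' v : cycle_reversal O O' -> indeg O' v = indeg O v.
Proof.
case=> s /and4P[_ /allP Os cyc_s uniq_s] ->.
have uniq_e : uniq (map fst s).
  rewrite map_inj_in_uniq ?(map_uniq uniq_s) // => -[e b] [f c] /Os /= /eqP Oe.
  by move=> /Os /= /eqP + eq_ef; rewrite -eq_ef Oe => -[->].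
set A := [set e in map fst s].
rewrite !indegE (bigID (mem A)) [RHS](bigID (mem A)) /=; congr (_ + _); last first.
  by apply: eq_bigr => e /negbTE eA; rewrite !towardsE ffunE eA.
have inA (F : E -> nat) : \sum_(e in A) F e = \sum_(d <- s) F d.1.
  rewrite -(big_map fst xpredT) big_uniq //=.
  by apply: eq_bigl => e; rewrite inE.
rewrite !inA.
transitivity (count_mem v [seq endpt d.1 (~~ d.2) | d <- s]).
  rewrite count_map -sum1_count [RHS]big_mkcond big_seq [RHS]big_seq; apply: eq_bigr => d ds.
  by rewrite towardsE ffunE inE map_f // (eqP (Os _ ds)) /=; case: (_ == v).
transitivity (count_mem v [seq endpt d.1 d.2 | d <- s]); last first.
  rewrite count_map -sum1_count big_mkcond big_seq [RHS]big_seq; apply: eq_bigr => d ds.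
  by rewrite towardsE (eqP (Os _ ds)) /=; case: (_ == v).
suff -> : [seq endpt d.1 (~~ d.2) | d <- s] = rotr 1 [seq endpt d.1 d.2 | d <- s].
  by rewrite /rotr; apply/permP; rewrite perm_rot.
apply: (canRL (rotK 1)).
case: s cyc_s {Os uniq_s uniq_e inA A} => //= d s; rewrite rot1_cons.
(* The dart at which the path starts is generalised; the dart that closes the cycle stays fixed. *)
elim: s {1 5 6}d => [|d' s IHs] c /=; first by rewrite andbT => /eqP->.
by case/andP=> /eqP-> /IHs->.
Qed.


(** * Partial orientations with equal indegrees *)

Lemma exists_directed_cycle (S : {pred V}) (P : pred (E * bool)) O v0 :
    {subset P <= [pred d | O d.1 == Some d.2]} -> v0 \in S ->
    {in S, forall v, exists d, [/\ P d, endpt d.1 (~~ d.2) = v & endpt d.1 d.2 \in S]} ->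
  exists2 s, directed_cycle O s & all P s.
Proof.
move=> PO Sv0 next.
(* Outside [S] the chosen dart is arbitrary; the one at [v0] serves. *)
have /fin_all_exists[d dP] v : exists d : E * bool, v \in S ->
    [/\ P d, endpt d.1 (~~ d.2) = v & endpt d.1 d.2 \in S].
  have [/next[d dP]|_] := boolP (v \in S); first by exists d.
  by have [d _] := next _ Sv0; exists d.
pose h v := endpt (d v).1 (d v).2.
have itS n : iter n h v0 \in S by elim: n => //= n /dP[].
(* Iterating [h] from [v0] must revisit a vertex. The loop starts at [x], the [i]-th iterate, and
   has length [m.+1]; its darts form the cycle. *)
have /trajectP[i lt_i eq_i] := looping_order h v0.
set x := iter i h v0 in eq_i.
have [m def_m] : exists m, order h v0 = i + m.+1.
  by exists (order h v0 - i.+1); rewrite addnS -addSn subnKC.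
have uniq_t : uniq (traject h x m.+1).
  by have := orbit_uniq h v0; rewrite /orbit def_m trajectD cat_uniq => /and3P[].
have eq_m : iter m.+1 h x = x by rewrite /x -iterD addnC -def_m.
have eq_t : rcons (traject h (h x) m) x = traject h (h x) m.+1.
  by rewrite trajectSr -iterSr eq_m.
have tS v : v \in traject h x m.+1 -> v \in S.
  by case/trajectP=> n _ ->; rewrite /x -iterD itS.
exists (map d (traject h x m.+1)); last first.
  by rewrite all_map; apply/allP => v /tS /dP[].
apply/and4P; split=> //.
- rewrite all_map; apply/allP => v /tS /dP[Pd _ _]; exact: PO.
- rewrite cycle_map; apply: (@sub_in_cycle _ (mem S) (frel h)).
  + by move=> v w Sv Sw /= /eqP; rewrite /h => ->; have [_ -> _] := dP _ Sw.
  + by apply/allP.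
  + by rewrite [cycle _ _]/= eq_t; exact: fpath_traject.
- rewrite -map_comp (_ : map _ _ = rot 1 (traject h x m.+1)) ?rot_uniq //.
  rewrite trajectS rot1_cons eq_t -trajectS.
  by elim: (m.+1) (x) => //= n IHn y; rewrite IHn.
Qed.

(** The two sets of edges directed to [v] have equal size, so if the first is not contained in the
    second, the second is not contained in the first. *)
Lemma indeg_exchange O O' e v : indeg O v = indeg O' v ->
  towards O e v -> ~~ towards O' e v -> exists2 f, towards O' f v & ~~ towards O f v.
Proof.
move=> eq_deg Oe O'e.
have /subsetPn[f] : ~~ ([set f | towards O' f v] \subset [set f | towards O f v]).
  apply/negP => sub; have /eqP eq_set : [set f | towards O' f v] == [set f | towards O f v].
    by rewrite eqEcard sub -[#|_|]/(indeg _ _) eq_deg /=.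
  by move: O'e; have := Oe; rewrite -(in_set (fun f => towards O f v)) -eq_set inE => ->.
by rewrite !inE => O'f Of; exists f.
Qed.

Lemma gccr_equiv_indeg O O' : indeg O =1 indeg O' -> gccr_equiv O O'.
Proof.
have [n] := ubnP #|[set e | O e != O' e]|; elim: n O => // n IHn O lt_n eq_deg.
have IH O2 : gccr_move O O2 -> indeg O2 =1 indeg O ->
    [set e | O2 e != O' e] \proper [set e | O e != O' e] -> gccr_equiv O O'.
  move=> mv eq_deg2 /proper_card lt2; apply: (rt_trans _ _ _ O2); first exact: rt_step.
  by apply: IHn => [|v]; [exact: leq_trans lt2 lt_n | rewrite eq_deg2].
have [-> | /eqP neq] := eqVneq O O'; first exact: rt_refl.
have [/existsP[v /existsP[e /existsP[f /and4P[Oe O'e O'f /eqP Of]]]]|noP] := boolP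
    [exists v, exists e, exists f,
      [&& towards O e v, ~~ towards O' e v, towards O' f v & O f == None]].
  (* Pivoting from [e] to [f] settles the disagreement at [f], and [e] was already one. *)
  have O'fE := O'f; move: O'fE; rewrite towardsE; case O'fb: (O' f) => [b|//] /eqP def_v.
  rewrite -def_v in Oe O'e O'f.
  apply: (IH _ (pivot_move Oe Of)) => [v'|]; first exact: indeg_pivot.
  have nef := towards_neq Oe Of.
  apply/properP; split; last first.
    by exists f; rewrite inE ?Of ?O'fb // ffunE (negbTE nef) eqxx eqxx.
  apply/subsetP => g; rewrite !inE ffunE; case: (g =P e) => [-> _|_].
    by apply: contraNneq O'e => eq_e; rewrite towardsE -eq_e -towardsE.
  by case: (g =P f) => // ->; rewrite O'fb eqxx.
(* [S] collects the vertices with an incoming edge of [O] that [O'] does not direct there. It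
   contains the head of every edge oriented by [O] on which the two differ. *)
pose S := [pred v | [exists e, towards O e v && ~~ towards O' e v]].
have S_head e b : O e = Some b -> O' e != Some b -> endpt e b \in S.
  move=> Oe O'e; apply/existsP; exists e; rewrite !towardsE Oe eqxx.
  case O'eb: (O' e) => [c|//]; rewrite (inj_eq (@endpt_inj e)).
  by apply: contraNneq O'e => <-; rewrite O'eb.
have [v0 Sv0] : exists v, v \in S.
  have [e neq_e] : exists e, O e != O' e.
    by apply/existsP; rewrite -negb_forall; apply: contra_notN neq => /eqfunP /ffunP.
  case Oe: (O e) => [b|]; first by exists (endpt e b); apply: S_head; rewrite // eq_sym -Oe.
  case O'e: (O' e) => [b|]; last by rewrite Oe O'e eqxx in neq_e.
  have [|||f Of O'f] := @indeg_exchange O' O e (endpt e b); rewrite ?towardsE ?O'e ?Oe //.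
  by exists (endpt e b); apply/existsP; exists f; apply/andP.
(* Darts of [O] that [O'] reverses. As no pivot applies, exchange at a vertex of [S] yields such a
   dart leaving it, and the head of this dart is again in [S]. *)
pose P (d : E * bool) := (O d.1 == Some d.2) && (O' d.1 == Some (~~ d.2)).
have [|||s cyc_s /allP Ps] := @exists_directed_cycle S P O v0 => //.
- by move=> d /andP[].
- move=> v /existsP[e /andP[Oe O'e]]; have [f O'f Of] := indeg_exchange (eq_deg v) Oe O'e.
  move: (O'f); rewrite towardsE; case O'fb: (O' f) => [b|//] /eqP def_v.
  have Ofb : O f = Some (~~ b).
    case Ofc: (O f) => [c|].
      by move: Of; rewrite towardsE Ofc -def_v; case: (b) (c) => [] []; rewrite ?eqxx.
    case/negP: noP; apply/existsP; exists v; apply/existsP; exists e.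
    by apply/existsP; exists f; rewrite Oe O'e O'f Ofc.
  exists (f, ~~ b); split; rewrite ?negbK // /P /= ?Ofb ?O'fb ?negbK ?eqxx //.
  by apply: S_head; rewrite // O'fb; case: (b).
have rev_s : cycle_reversal O (reverse [set e in map fst s] O) by exists s.
apply: (IH _ (Or33 _ _ rev_s)) => [v|]; first exact: indeg_cycle_reversal.
have sE e : e \in map fst s -> omap negb (O e) = O' e /\ O e != O' e.
  case/mapP=> d /Ps /andP[/eqP Od /eqP O'd] ->; rewrite Od O'd.
  by split=> //; apply/eqP => -[]; case: (d.2).
apply/properP; split.
  by apply/subsetP=> e; rewrite !inE ffunE inE; case: ifP => // /sE[->]; rewrite eqxx.
case/and4P: cyc_s => s_n0 _ _ _.
case: s s_n0 sE {rev_s Ps} => // d s _ sE; have [O'd neq_d] := sE d.1 (mem_head _ _).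
by exists d.1; rewrite inE ?neq_d // ffunE inE mem_head O'd eqxx.
Qed.


(** * Directed cuts from augmenting paths *)

Lemma cutE X e b : (e \in cut X) = ((endpt e b \in X) != (endpt e (~~ b) \in X)).
Proof. by rewrite inE; case: b => //; rewrite eq_sym. Qed.

Lemma sum_indeg (P : pred V) O :
  \sum_(v | P v) indeg O v = #|[set e | if O e is Some b then P (endpt e b) else false]|.
Proof.
under eq_bigr do rewrite indegE.
rewrite exchange_big -sum1_card [RHS]big_mkcond; apply: eq_bigr => e _ /=.
rewrite inE; under eq_bigr do rewrite towardsE.
case: (O e) => [b|]; last by rewrite big1.
rewrite big_mkcond (bigD1 (endpt e b)) //= eqxx big1 ?addn0; first by case: (P _).
by move=> v /negbTE; rewrite eq_sym => ->; case: (P v).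
Qed.

Section FiringCut.
Variables (X : {set V}) (O0 : porient G).

Definition into O : {set E} :=
  [set e in cut X | if O e is Some b then endpt e b \in X else false].

Lemma intoE O e :
  (e \in into O) = (e \in cut X) && (if O e is Some b then endpt e b \in X else false).
Proof. by rewrite [in LHS]inE. Qed.

(** Only the head must avoid [X], so a path starting in [X] leaves it at the first step and never
    returns. *)
Definition out_step O : rel V := fun u w =>
  [exists e, exists b, [&& O e == Some b, endpt e (~~ b) == u, endpt e b == w & w \notin X]].

Hypothesis indeg_ge : {in X, forall v, #|[set e in cut X | incident e v]| <= indeg O0 v}.

Variable O1 : porient G.
Hypothesis O1_max : forall O, indeg O =1 indeg O0 -> #|into O| <= #|into O1|.

(* An unoriented edge at the end of the path slides back along it by pivots,
   until a last pivot at [v] turns a cut edge into [X]. *)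
Lemma no_augmenting_path p O v g :
    indeg O =1 indeg O0 -> #|into O| = #|into O1| -> v \in X ->
    path (out_step O) v p -> uniq (v :: p) ->
    O g = None -> incident g (last v p) -> ~ (p = [::] -> g \in cut X).
Proof.
elim/last_ind: p O g => [|p x IHp] O g degO max_O Xv.
  move=> _ _ Og /incidentP[b def_v] /(_ erefl) cut_g.
  (* By [indeg_ge], at least as many edges enter [v] as there are cut edges at [v]. The cut edge [g]
     is not among those entering, so some entering edge lies off the cut; pivoting from it to [g]
     enlarges [into], against maximality. *)
  have [e Oe cut_e] : exists2 e, towards O e v & e \notin cut X.
    have /subsetPn[e] : ~~ ([set e | towards O e v] \subset
                            [set e in cut X | incident e v]).
      apply/negP => sub; have /eqP/setP/(_ g) : [set e | towards O e v] ==
          [set e in cut X | incident e v].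
        by rewrite eqEcard sub /= -[#|[set e | towards O e v]|]/(indeg O v) degO indeg_ge.
      rewrite !inE towardsE Og => /esym/negP; apply.
      by rewrite inE in cut_g; rewrite cut_g; apply/incidentP; exists b.
    rewrite inE => Oe; rewrite !inE negb_and => /orP[cut_e|/incidentP[]].
      by exists e; rewrite // inE.
    by move/existsP: Oe => [c /andP[_ /eqP]]; exists c.
  rewrite /= in def_v; rewrite -def_v in Oe.
  have : #|into (pivot O e g b)| <= #|into O|.
    by rewrite max_O; apply: O1_max => u; rewrite indeg_pivot.
  have nge := towards_neq Oe Og.
  apply/negP; rewrite -ltnNge; apply/proper_card/properP; split.
    apply/subsetP => f; rewrite !intoE => /andP[cut_f Of].
    rewrite cut_f ffunE; case: (f =P e) => [ef|_]; first by rewrite -ef cut_f in cut_e.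
    by case: (f =P g) => // fg; rewrite fg Og in Of.
  exists g; last by rewrite intoE Og andbF.
  by rewrite intoE cut_g ffunE (negbTE nge) eqxx def_v.
rewrite rcons_path last_rcons -rcons_cons rcons_uniq => /andP[path_p].
case/existsP=> h /existsP[c /and4P[/eqP Oh /eqP def_u /eqP def_x Xx]].
case/andP=> vp_x uniq_p Og /incidentP[b gx] _.
have Oh' : towards O h (endpt g b) by rewrite towardsE Oh gx def_x.
have nhg := towards_neq Oh' Og.
(* Both [h] and [g] get their orientation towards [x], outside [X], so [into] is unchanged. The
   shorter path avoids [x] and survives, and [h] is now the unoriented edge at its end. *)
pose O3 := pivot O h g b.
apply: (IHp O3 h) => //.
- by move=> u; rewrite indeg_pivot.
- rewrite -max_O; congr #|pred_of_set _|; apply/setP => e; rewrite !intoE; congr (_ && _).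
  rewrite ffunE; case: (e =P h) => [->|_]; first by rewrite Oh def_x (negbTE Xx).
  by case: (e =P g) => [->|//]; rewrite Og gx (negbTE Xx).
- apply: (@sub_in_path _ (predC1 x) (out_step O)) path_p.
    move=> u w _ /= wx /existsP[e /existsP[d /and4P[/eqP Oe eu ew Xw]]].
    apply/existsP; exists e; apply/existsP; exists d; rewrite eu ew Xw ffunE.
    case: (e =P h) => [eh|_].
      by move: Oe wx; rewrite eh Oh -(eqP ew) eh => -[<-]; rewrite inE def_x eqxx.
    by case: (e =P g) => [eg|_]; [rewrite eg Og in Oe | rewrite Oe eqxx].
  by apply/allP => u up /=; apply: contraNneq vp_x => <-.
- by rewrite ffunE eqxx.
- by apply/incidentP; exists (~~ c).
- by move=> p0; rewrite (cutE _ _ c) def_x def_u p0 /= Xv (negbTE Xx).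
Qed.

Hypothesis degO1 : indeg O1 =1 indeg O0.

Definition out_reach : {set V} := [set w | [exists v in X, connect (out_step O1) v w]].

Lemma sub_out_reach : X \subset out_reach.
Proof.
by apply/subsetP => v Xv; rewrite inE; apply/existsP; exists v; rewrite Xv connect0.
Qed.

Lemma oriented_out_reach g w : w \in out_reach -> incident g w ->
  (w \in X -> g \in cut X) -> O1 g != None.
Proof.
rewrite inE => /existsP[v /andP[Xv /connectP[p path_p def_w]]] gw cut_g.
apply/eqP => Og; move: gw cut_g; rewrite def_w.
case/shortenP: path_p => q path_q uniq_q _ gw cut_g.
apply: (no_augmenting_path degO1 erefl Xv path_q uniq_q Og gw) => q0.
by rewrite q0 in cut_g; exact: cut_g.
Qed.

(** Such an edge is oriented, since otherwise it would end an augmenting path. Were it directed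
    outwards, its head, which is not in [X], would be reachable too. *)
Lemma cut_out_reach e : e \in cut out_reach ->
  exists2 b, O1 e = Some b & endpt e b \in out_reach.
Proof.
move=> cut_e; have [b Rb Rnb] : exists2 b, endpt e b \in out_reach &
    endpt e (~~ b) \notin out_reach.
  move: cut_e; rewrite (cutE _ _ false) /=.
  have [Rf|Rf] := boolP (endpt e false \in _); have [Rt|Rt] := boolP (endpt e true \in _) => // _.
    by exists false.
  by exists true.
have Xnb : endpt e (~~ b) \notin X by apply: contra Rnb; apply: (subsetP sub_out_reach).
have := oriented_out_reach (g := e) Rb.
case O1e: (O1 e) => [c|] oriented; last first.
  suff : @None bool != None by [].
  apply: oriented; first by apply/incidentP; exists b.
  by rewrite (cutE _ _ b) (negbTE Xnb) => ->.
exists c => //; have [->//|nbc] := eqVneq c b.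
have {nbc}def_c : c = ~~ b by case: c b nbc {O1e oriented Rb Rnb Xnb} => [] [].
case/negP: Rnb; move: Rb; rewrite !inE => /existsP[v /andP[Xv v_b]].
apply/existsP; exists v; rewrite Xv; apply: connect_trans v_b (connect1 _).
by apply/existsP; exists e; apply/existsP; exists c; rewrite O1e def_c negbK !eqxx.
Qed.

(** If everything were reachable, each edge with an end outside [X] would be oriented, with its head
    outside [X] or else in [into]. The assumed inequality then forces the whole cut to point into
    [X], so no path leaves [X] and [X] is everything. *)
Lemma out_reach_neqT : X != setT ->
    \sum_(v | v \notin X) indeg O0 v + #|cut X|
      <= #|[set e | [exists b, endpt e b \notin X]]| ->
  out_reach != setT.
Proof.
move=> XT; under eq_bigr do rewrite -degO1; rewrite sum_indeg => le_deg.
apply: contraNneq XT => RT; rewrite -subTset -RT.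
have sub_cut : cut X \subset into O1.
  have -> : cut X = into O1; last exact: subxx.
  apply/esym/eqP; rewrite eqEcard; apply/andP; split.
    by apply/subsetP => e; rewrite intoE => /andP[].
  rewrite -(leq_add2l #|[set e | if O1 e is Some b then endpt e b \notin X else false]|).
  apply: leq_trans le_deg (leq_trans (subset_leq_card _) (leq_card_setU _ _)).
  apply/subsetP => e; rewrite inE => /existsP[b Xb].
  have : O1 e != None.
    apply: (@oriented_out_reach e (endpt e b)); rewrite ?RT ?inE //; last by rewrite (negbTE Xb).
    by apply/incidentP; exists b.
  rewrite in_setU intoE in_set; case: (O1 e) => // c _.
  have [Xc|//] := boolP (endpt e c \in X); rewrite andbT /= (cutE _ _ c) Xc /=.
  suff -> : ~~ c = b by rewrite (negbTE Xb).
  by apply/eqP; apply: contraNT Xb; case: b c Xc => [] [].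
apply/subsetP => w; rewrite inE => /existsP[v /andP[Xv /connectP[p path_p ->]]] {w}.
elim: p v Xv path_p => //= w p IHp v Xv /andP[/existsP[e /existsP[b]]].
case/and4P=> /eqP O1e /eqP def_v /eqP def_w Xw; apply: IHp.
have /(subsetP sub_cut) : e \in cut X by rewrite (cutE _ _ b) def_v def_w Xv (negbTE Xw).
by rewrite intoE O1e def_w => /andP[].
Qed.

End FiringCut.

Lemma exists_directed_cut O X : X != setT ->
    {in X, forall v, #|[set e in cut X | incident e v]| <= indeg O v} ->
    \sum_(v | v \notin X) indeg O v + #|cut X|
      <= #|[set e | [exists b, endpt e b \notin X]]| ->
  exists O1 X1, [/\ indeg O1 =1 indeg O, X \subset X1, X1 != setT &
    forall e, e \in cut X1 -> exists2 b, O1 e = Some b & endpt e b \in X1].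
Proof.
move=> XT ge_cut le_deg.
case: (@arg_maxnP _ O (fun O1 => [forall v, indeg O1 v == indeg O v]) (fun O1 => #|into X O1|)).
  by apply/forallP.
move=> O1 /eqfunP degO1 O1_max.
have max O2 : indeg O2 =1 indeg O -> #|into X O2| <= #|into X O1|.
  by move=> degO2; apply: O1_max; apply/eqfunP.
exists O1, (out_reach X O1); split=> //.
- exact: sub_out_reach.
- exact: out_reach_neqT le_deg.
- exact: cut_out_reach ge_cut _ max degO1.
Qed.

Local Open Scope ring_scope.

(** * The Laplacian edge by edge, and its relation to the moves *)

Lemma Posz_sum (I : finType) (P : pred I) (F : I -> nat) :
  (\sum_(i | P i) F i)%N%:Z = \sum_(i | P i) (F i)%:Z.
Proof. by rewrite -[LHS]natz natr_sum; apply: eq_bigr => i _; rewrite natz. Qed.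

(** The Laplacian applied to [c], as a sum over edge ends, so that identities with indegrees can be
    checked one edge at a time. *)
Definition lap (c : V -> int) v : int :=
  \sum_e \sum_b (if endpt e b == v then c (endpt e b) - c (endpt e (~~ b)) else 0).

Lemma eq_lap c c' : c =1 c' -> lap c =1 lap c'.
Proof. by move=> eq_c v; do 2!apply: eq_bigr => ? _; rewrite !eq_c. Qed.

(** The right side is [lap] of the indicator of [v]. Since there are no loops, at most one end of an
    edge contributes at [w]. *)
Lemma laplacianE w v : laplacian w v =
  \sum_e \sum_b (if endpt e b == w then (v == w)%:Z - (v == endpt e (~~ b))%:Z else 0).
Proof.
rewrite /laplacian; case: (eqVneq w v) => [<-|wv]; rewrite ?eqxx.
  rewrite /deg -sum1_card big_mkcond Posz_sum; apply: eq_bigr => e _.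
  rewrite inE big_bool /=; have [et|et] := eqVneq (endpt e true) w.
    have -> : (endpt e false == w) = false by rewrite -et endpt_eqN.
    have -> : (w == endpt e false) = false by rewrite -et endpt_eqN.
    by case: incidentP => // -[]; exists true.
  have [ef|ef] := eqVneq (endpt e false) w.
    by case: incidentP => // -[]; exists false.
  by case: incidentP => // -[] [] /eqP; rewrite ?(negbTE et) ?(negbTE ef).
rewrite /mult -sum1_card big_mkcond Posz_sum -sumrN; apply: eq_bigr => e _.
have joinsE : joins e v w = ((endpt e true == v) && (endpt e false == w)) ||
    ((endpt e false == v) && (endpt e true == w)).
  by apply/existsP/orP => [[[]]|[]]; [left|right|exists true|exists false].
rewrite inE big_bool /= joinsE !(eq_sym v).
have [et|et] := eqVneq (endpt e true) w; have [ef|ef] := eqVneq (endpt e false) w.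
- by have := endpt_neq e; rewrite et ef eqxx.
- by rewrite et (negbTE wv) andbT /=; case: (_ == v).
- by rewrite ef (negbTE wv) andbF orbF andbT; case: (_ == v).
- by rewrite !andbF.
Qed.

Lemma laplacian_sum c w : \sum_v laplacian w v * c v = lap c w.
Proof.
under eq_bigr do rewrite laplacianE mulr_suml.
rewrite exchange_big; apply: eq_bigr => e _ /=.
under eq_bigr do rewrite mulr_suml.
rewrite exchange_big; apply: eq_bigr => b _ /=.
have [<-|_] := eqVneq; last by rewrite big1 // => v _; rewrite mul0r.
have ind x : \sum_v (v == x)%:Z * c v = c x.
  by rewrite (bigD1 x) //= eqxx mul1r big1 ?addr0 // => v /negbTE->; rewrite mul0r.
by under eq_bigr do rewrite mulrBl; rewrite sumrB !ind.
Qed.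

Lemma lin_equiv_lap O O' : lin_equiv (orient_div O) (orient_div O') <->
  exists c, forall v, (indeg O v)%:Z - (indeg O' v)%:Z = lap c v.
Proof.
rewrite lin_equivP; split=> -[c Hc]; exists c => v; move: (Hc v);
  by rewrite laplacian_sum !ffunE opprD opprK addrACA addNr addr0.
Qed.

(** Each cut edge passes one unit of indegree from its head to its tail, which amounts to firing all
    vertices on the side of the heads. Off the cut the indicator is constant along edges. *)
Lemma indeg_reverse_cut O X inward :
    (forall e, e \in cut X -> exists2 b, O e = Some b & (endpt e b \in X) = inward) ->
  forall v, (indeg O v)%:Z - (indeg (reverse (cut X) O) v)%:Z
    = lap (fun u => ((u \in X) == inward)%:Z) v.
Proof.
move=> dirX v; rewrite !indegE !Posz_sum -sumrB; apply: eq_bigr => e _.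
rewrite big_bool /= !towardsE ffunE; case: ifP => [cut_e|].
  have [b Oe eb] := dirX e cut_e; move: cut_e; rewrite (cutE _ _ b) eb Oe /= => enb.
  have {enb} : (endpt e (~~ b) \in X) = ~~ inward by case: (_ \in X) inward enb {eb dirX} => [] [].
  by case: b eb {Oe} => /= -> ->; rewrite eqxx; case: inward {dirX};
     do 2!case: (_ == v).
rewrite (cutE _ _ true) /= => /negbFE/eqP->.
by rewrite subrr; do 2!case: ifP; rewrite subrr.
Qed.

Lemma gccr_move_lin_equiv O O' :
  gccr_move O O' -> lin_equiv (orient_div O) (orient_div O').
Proof.
have same : indeg O' =1 indeg O -> lin_equiv (orient_div O) (orient_div O').
  move=> eq_deg; suff -> : orient_div O' = orient_div O by apply: rt_refl.
  by apply/ffunP => v; rewrite !ffunE eq_deg.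
case=> [[v [e [f [b [Oe Of fb defO']]]]]|[X [_ _ [inward dirX] ->]]|cyc].
- by apply: same => u; rewrite -fb in Oe; rewrite defO'; exact: indeg_pivot.
- apply/lin_equiv_lap; exists (fun u => ((u \in X) == inward)%:Z).
  exact: indeg_reverse_cut.
- by apply: same => v; exact: indeg_cycle_reversal.
Qed.

(** * Indegree bounds from the zero set of a firing vector *)

Section TopLevel.
Variables (a : V -> nat) (O O' : porient G).
Hypothesis degO' : forall v, (indeg O' v)%:Z - (indeg O v)%:Z = lap (fun u => (a u)%:Z) v.
Let X := [set v | a v == 0%N].

(** As [a] is minimal at [v], every edge there contributes at most 0 to [lap], and a cut edge at
    most -1; but [lap] at [v] is at least minus the indegree in [O]. *)
Lemma indeg_ge_cut : {in X, forall v, (#|[set e in cut X | incident e v]| <= indeg O v)%N}.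
Proof.
move=> v; rewrite inE => /eqP av.
suff : lap (fun u => (a u)%:Z) v <= - #|[set e in cut X | incident e v]|%:Z.
  by rewrite -degO'; lia.
rewrite -sum1_card big_mkcond Posz_sum -sumrN; apply: ler_sum => e _.
rewrite in_set big_bool /=.
have Xb b : (endpt e b \in X) = (a (endpt e b) == 0%N) by rewrite inE.
case: (boolP (_ && incident e v)) => [/andP[cut_e /incidentP[b eb]]|_].
  move: cut_e; rewrite (cutE _ _ b) !Xb eb av /= => nb0.
  have := endpt_eqN e b; rewrite eb eq_sym => nbv.
  by case: b eb nb0 nbv => /= -> + ->; rewrite eqxx av eqxx; lia.
by do 2!case: eqP => [->|_]; rewrite ?av; lia.
Qed.

(** Summed outside [X], the contributions of edges with both ends there cancel, and each cut edge
    gives the positive value of [a] at its outer end. The indegrees of [O'] outside [X] count only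
    edges with an end there. *)
Lemma sum_indeg_cut :
  (\sum_(v | v \notin X) indeg O v + #|cut X|
     <= #|[set e | [exists b, endpt e b \notin X]]|)%N.
Proof.
have Xb u : (u \in X) = (a u == 0%N) by rewrite inE.
have le_O' : (\sum_(v | v \notin X) indeg O' v <= #|[set e | [exists b, endpt e b \notin X]]|)%N.
  rewrite sum_indeg; apply/subset_leq_card/subsetP => e; rewrite !inE.
  by case: (O' e) => // b Xb'; apply/existsP; exists b.
suff : #|cut X|%:Z <= \sum_(v | v \notin X) ((indeg O' v)%:Z - (indeg O v)%:Z).
  by rewrite sumrB -!Posz_sum; lia.
under eq_bigr do rewrite degO'.
rewrite exchange_big -sum1_card big_mkcond Posz_sum; apply: ler_sum => e _ /=.
rewrite exchange_big big_bool /=.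
have ind b (x : int) : \sum_(v | v \notin X) (if endpt e b == v then x else 0)
    = if endpt e b \notin X then x else 0.
  rewrite big_mkcond (bigD1 (endpt e b)) //= eqxx big1 ?addr0 // => v.
  by rewrite eq_sym => /negbTE->; case: ifP.
rewrite !ind (cutE _ _ true) /= !Xb.
by case: (a (endpt e true) =P _) => ?; case: (a (endpt e false) =P _) => ? /=; lia.
Qed.

End TopLevel.

(** * Induction on the firing vector *)

Lemma gccr_equiv_lap (a : V -> nat) v0 O O' : a v0 = 0%N ->
    (forall v, (indeg O' v)%:Z - (indeg O v)%:Z = lap (fun u => (a u)%:Z) v) ->
  gccr_equiv O O'.
Proof.
have [n] := ubnP (\sum_v a v)%N; elim: n => // n IHn in a O * => lt_n av0 degO'.
pose X := [set v | a v == 0%N].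
have [/setP XT|XnT] := eqVneq X setT.
  apply: gccr_equiv_indeg => v; apply/eqP; rewrite -eqz_nat eq_sym -subr_eq0 degO'.
  have a0 u : a u = 0%N by have := XT u; rewrite !inE => /eqP.
  by rewrite /lap big1 // => e _; rewrite big1 // => b _; rewrite !a0 subrr if_same.
have [O1 [X1 [degO1 XX1 X1nT dirX1]]] :=
  exists_directed_cut XnT (indeg_ge_cut degO') (sum_indeg_cut degO').
have Xv0 : v0 \in X1 by apply: (subsetP XX1); rewrite inE av0.
have a_gt0 v : v \notin X1 -> (0 < a v)%N.
  by rewrite lt0n; apply: contra => av; apply: (subsetP XX1); rewrite inE.
apply: (rt_trans _ _ _ O1); first by apply: gccr_equiv_indeg => v; rewrite degO1.
apply: (rt_trans _ _ _ (reverse (cut X1) O1)).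
  apply/rt_step/Or32; exists X1; split=> //; last by exists true.
  by apply/set0Pn; exists v0.
(* Natural subtraction does not truncate here, by [a_gt0]. *)
apply: (IHn (fun v => a v - (v \notin X1))%N).
- apply: (@leq_trans (\sum_v a v)%N) => //.
  have /subsetPn[w _ X1w] : ~~ (setT \subset X1) by rewrite subTset.
  rewrite (bigD1 w) //= [ltnRHS](bigD1 w) //= -addSn leq_add //.
    by rewrite X1w -subSn ?a_gt0 // subn1.
  by apply: leq_sum => v _; rewrite leq_subr.
- by rewrite av0.
move=> v.
(* The reversal adds the indicator of [X1] to the firing vector; modulo constants, which [lap]
   kills, this subtracts one off [X1]. *)
have -> : (indeg O' v)%:Z - (indeg (reverse (cut X1) O1) v)%:Z =
    lap (fun u => (a u)%:Z) v + lap (fun u => ((u \in X1) == true)%:Z) v.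
  by rewrite -degO' -(indeg_reverse_cut dirX1) degO1; lia.
rewrite /lap -big_split; apply: eq_bigr => e _; rewrite -big_split.
apply: eq_bigr => b _ /=; case: ifP => _; rewrite ?addr0 //.
have := a_gt0 (endpt e b); have := a_gt0 (endpt e (~~ b)).
by do 2!case: (_ \in X1) => /=; lia.
Qed.

End Graph.

Theorem theorem1p2 (G : multigraph) (hG : connected G) (O O' : porient G) :
  gccr_equiv O O' <-> lin_equiv (orient_div O) (orient_div O').
Proof.
split=> [|/lin_equiv_lap[c degO]].
  elim=> [{}O {}O' /gccr_move_lin_equiv|{}O|O1 O2 O3 _ H12 _ H23] //.
    exact: rt_refl.
  exact: rt_trans H12 H23.
have /card_gt0P[v0 _] := hG.1.
have [v1 _ c_max] := @Order.TotalTheory.arg_maxP _ _ _ v0 xpredT c isT.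
have c_le v : (c v <= c v1)%R by exact: c_max.
(* Subtracting [c] from its maximum gives a nonnegative vector that vanishes at [v1]; its [lap] is
   the negative of that of [c]. *)
apply: (@gccr_equiv_lap _ (fun v => `|c v1 - c v|%N) v1); first by rewrite subrr.
move=> v; rewrite -opprB degO /lap -sumrN; apply: eq_bigr => e _.
rewrite -sumrN; apply: eq_bigr => b _; case: ifP => _; rewrite ?oppr0 //.
have := c_le (endpt e b); have := c_le (endpt e (~~ b)); lia.
Qed.
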